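(* Let $\mathbf{K}$ be one of the following countable structures: (i) a countably infinite set with no structure; (ii) the random $K_n$-free graph for some $n\geq 3$ (the Fraïssé limit of the class of finite graphs containing no clique of size $n$); (iii) the random $r$-uniform hypergraph for some $r\geq 2$ (the Fraïssé limit of the class of finite $r$-uniform hypergraphs). Let $G=\mathrm{Aut}(\mathbf{K})$ with the topology of pointwise convergence. Then $S(G)$ and $E(M(G))$ are not isomorphic as $G$-ambits; i.e. the canonical map of ambits $S(G)\to E(M(G))$ is not an isomorphism.
   Context: A $G$-flow is a compact Hausdorff space with a continuous right action of $G$; a $G$-ambit is a pair $(X,x_0)$ with $X$ a $G$-flow and $x_0$ having dense orbit; a map of ambits is a continuous $G$-equivariant map sending distinguished point to distinguished point. $S(G)$ is the Samuel compactification of $G$ with respect to its left uniformity (Gelfand space of bounded left-uniformly continuous functions), which with distinguished point $1_G$ and the extension of right multiplication is the greatest $G$-ambit. $M(G)$ denotes the universal minimal flow of $G$ (the unique minimal $G$-flow admitting a $G$-map onto every minimal $G$-flow). For a $G$-flow $X$, the enveloping semigroup $E(X)$ is the closure in $X^X$ (product topology) of the maps $\rho_g:x\mapsto xg$, $g\in G$, an ambit with distinguished point $\rho_{1_G}$ and action $x(f\cdot g)=(xf)g$; there is a unique map of ambits $S(G)\to E(X)$. *)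

(* Defs.v *)
From mathcomp Require Import all_boot all_order all_algebra.
From mathcomp Require Import all_classical all_reals all_analysis.

Set Implicit Arguments.
Unset Strict Implicit.
Unset Printing Implicit Defensive.

Local Open Scope classical_set_scope.

(* A group G of permutations of nat is represented as a set of functions *)
(* nat -> nat; its topology is the subspace topology of {ptws nat -> nat} *)
(* (pointwise convergence, nat discrete).  Group product: g h := g \o h.  *)

Definition Sym_nat : set (nat -> nat) := [set g | bijective g].

Definition is_graph {V : Type} (E : V -> V -> Prop) : Prop :=
  (forall x y, E x y -> E y x) /\ (forall x, ~ E x x).

Definition Kn_free {V : Type} (n : nat) (E : V -> V -> Prop) : Prop :=
  ~ exists f : 'I_n -> V, injective f /\ (forall i j, i != j -> E (f i) (f j)).

Definition graph_aut (E : nat -> nat -> Prop) : set (nat -> nat) :=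
  [set g | bijective g /\ forall x y, E x y <-> E (g x) (g y)].

Definition graph_ultrahomogeneous (E : nat -> nat -> Prop) : Prop :=
  forall (A : set nat) (p : nat -> nat), finite_set A ->
    {in A &, injective p} ->
    (forall x y, A x -> A y -> (E x y <-> E (p x) (p y))) ->
    exists g, graph_aut E g /\ forall x, A x -> g x = p x.

(** the random K_n-free graph: the Fraisse limit of the class of finite
    K_n-free graphs (countable, ultrahomogeneous, age = that class) *)
Definition random_Kn_free_graph (n : nat) (E : nat -> nat -> Prop) : Prop :=
  [/\ is_graph E, Kn_free n E,
      (forall (m : nat) (F : 'I_m -> 'I_m -> Prop), is_graph F -> Kn_free n F ->
         exists e : 'I_m -> nat, injective e /\
           forall i j, F i j <-> E (e i) (e j))
    & graph_ultrahomogeneous E].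

Definition is_hypergraph {V : Type} (r : nat) (H : ('I_r -> V) -> Prop) : Prop :=
  (forall t, H t -> injective t) /\
  (forall t (s : 'I_r -> 'I_r), bijective s -> H t -> H (t \o s)).

Definition hyp_aut (r : nat) (H : ('I_r -> nat) -> Prop) : set (nat -> nat) :=
  [set g | bijective g /\ forall t, H t <-> H (g \o t)].

Definition hyp_ultrahomogeneous (r : nat) (H : ('I_r -> nat) -> Prop) : Prop :=
  forall (A : set nat) (p : nat -> nat), finite_set A ->
    {in A &, injective p} ->
    (forall t : 'I_r -> nat, (forall i, A (t i)) -> (H t <-> H (p \o t))) ->
    exists g, hyp_aut H g /\ forall x, A x -> g x = p x.

Definition random_hypergraph (r : nat) (H : ('I_r -> nat) -> Prop) : Prop :=
  [/\ is_hypergraph H,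
      (forall (m : nat) (F : ('I_r -> 'I_m) -> Prop), is_hypergraph F ->
         exists e : 'I_m -> nat, injective e /\
           forall t, F t <-> H (e \o t))
    & hyp_ultrahomogeneous H].

Definition theorem_group (G : set (nat -> nat)) : Prop :=
  G = Sym_nat \/
  (exists (n : nat) (E : nat -> nat -> Prop),
      (3 <= n)%N /\ random_Kn_free_graph n E /\ G = graph_aut E) \/
  (exists (r : nat) (H : ('I_r -> nat) -> Prop),
      (2 <= r)%N /\ random_hypergraph H /\ G = hyp_aut H).

(** G-flow: compact Hausdorff X with a continuous right action of G
    (x(gh) = (xg)h with gh = g \o h); only values at g in G matter. *)
Definition is_flow (G : set (nat -> nat)) (X : topologicalType)
    (act : X -> (nat -> nat) -> X) : Prop :=
  [/\ compact [set: X], hausdorff_space X,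
      (forall x, act x id = x),
      (forall x g h, G g -> G h -> act (act x g) h = act x (g \o h))
    & {within [set: X] `*` (G : set {ptws nat -> nat}),
        continuous (fun p : X * {ptws nat -> nat} => act p.1 p.2)}].

Definition orbit (G : set (nat -> nat)) {X : Type} (act : X -> (nat -> nat) -> X)
    (x : X) : set X := [set act x g | g in G].

Definition is_ambit (G : set (nat -> nat)) (X : topologicalType)
    (act : X -> (nat -> nat) -> X) (x0 : X) : Prop :=
  is_flow G act /\ closure (orbit G act x0) = [set: X].

Definition G_map (G : set (nat -> nat)) (X Y : topologicalType)
    (actX : X -> (nat -> nat) -> X) (actY : Y -> (nat -> nat) -> Y)
    (phi : X -> Y) : Prop :=
  continuous phi /\ forall x g, G g -> phi (actX x g) = actY (phi x) g.

Definition ambit_map (G : set (nat -> nat)) (X Y : topologicalType)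
    (actX : X -> (nat -> nat) -> X) (actY : Y -> (nat -> nat) -> Y)
    (x0 : X) (y0 : Y) (phi : X -> Y) : Prop :=
  G_map G actX actY phi /\ phi x0 = y0.

Definition greatest_ambit (G : set (nat -> nat)) (X : topologicalType)
    (act : X -> (nat -> nat) -> X) (x0 : X) : Prop :=
  is_ambit G act x0 /\
  forall (Y : topologicalType) (actY : Y -> (nat -> nat) -> Y) (y0 : Y),
    is_ambit G actY y0 -> exists phi : X -> Y, ambit_map G act actY x0 y0 phi.

Definition minimal_flow (G : set (nat -> nat)) (X : topologicalType)
    (act : X -> (nat -> nat) -> X) : Prop :=
  [/\ is_flow G act, [set: X] !=set0 &
      forall A : set X, closed A -> A !=set0 ->
        (forall x g, G g -> A x -> A (act x g)) -> A = [set: X]].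

Definition universal_minimal_flow (G : set (nat -> nat)) (M : topologicalType)
    (act : M -> (nat -> nat) -> M) : Prop :=
  minimal_flow G act /\
  forall (Y : topologicalType) (actY : Y -> (nat -> nat) -> Y),
    minimal_flow G actY ->
    exists phi : M -> Y, G_map G act actY phi /\ (forall y, exists x, phi x = y).

Definition enveloping_semigroup (G : set (nat -> nat)) (X : topologicalType)
    (act : X -> (nat -> nat) -> X) : set {ptws X -> X} :=
  closure ([set (fun x => act x g) | g in G] : set {ptws X -> X}).

Definition ambit_iso_enveloping (G : set (nat -> nat)) (X : topologicalType)
    (actX : X -> (nat -> nat) -> X) (x0 : X) (Y : topologicalType)
    (actY : Y -> (nat -> nat) -> Y) : Prop :=
  exists (phi : X -> {ptws Y -> Y}) (psi : {ptws Y -> Y} -> X),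
    [/\ continuous phi,
        (forall x, enveloping_semigroup G actY (phi x)),
        (forall x g, G g -> phi (actX x g) = (fun y => actY (phi x y) g)) &
        phi x0 = (fun y : Y => y)] /\
    [/\
        {within enveloping_semigroup G actY, continuous psi},
        (forall x, psi (phi x) = x) &
        (forall f, enveloping_semigroup G actY f -> phi (psi f) = f)].

(* Main.v *)
Require Import Defs.
From mathcomp Require Import all_boot all_order all_algebra zify.
From mathcomp Require Import all_classical all_reals all_analysis.
From Stdlib Require List.

(* All the structures are Fraisse limits of classes of finite r-uniform
   hypergraphs omitting irreducible substructures of given sizes (a set is the
   limit of the K_2-free graphs).  By the partite construction of Nesetril and
   Rodl these classes have the Ramsey property with respect to linear orders.
   Hence, if M is a minimal flow and P is a neighbourhood slightly smaller than
   Q, then for every y in M, on every finite set of vertices there is an order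
   such that yg in P implies yg' in Q whenever g and g' have the same order type
   on a fixed initial segment [0, m).

   Choose a binary relation z on the vertices with dense orbit in the full shift;
   it is the base point of an ambit, so if S(G) were E(M), the function
   g |-> z (g 0, g 1) would extend continuously to the compact space E(M), and
   would depend only on the order types of g for finitely many orders.  But there
   are vertices a_j (j < n), b_w (w in 2^n), interchangeable over the rest of
   [0, m), with z (a_j, b_w) = w j, while k orders distinguish only polynomially
   many (in n) positions of b_w. *)

Set Implicit Arguments.
Unset Strict Implicit.
Unset Printing Implicit Defensive.

Local Open Scope classical_set_scope.
Local Open Scope nat_scope.

(** * The theorems of Hales-Jewett and Ramsey *)

(** A word over [option L] is a template of a combinatorial line: [None] marks its active
    coordinates. *)
Definition fill (I L : Type) (w : I -> option L) (x : L) : I -> L :=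
  fun i => odflt x (w i).

Definition juxt (J I L : Type) (u : J -> L) (v : I -> L) : J + I -> L :=
  fun k => match k with inl j => u j | inr i => v i end.

Definition mono_line (I L : Type) (C : eqType) (chi : (I -> L) -> C) :=
  exists2 w : I -> option L, exists i, w i = None &
    forall x y, chi (fill w x) = chi (fill w y).

Definition hales_jewett_for (L : finType) := forall C : finType,
  exists I : finType, forall chi : (I -> L) -> C, mono_line chi.

Lemma hales_jewett_bij (L L' : finType) (f : L -> L') : bijective f ->
  hales_jewett_for L -> hales_jewett_for L'.
Proof.
move=> [g fK gK] HJ C; have [I HI] := HJ C; exists I => chi.
have [w [i wi] Hw] := HI (fun u => chi (f \o u)).
exists (fun i => omap f (w i)); first by exists i; rewrite wi.
have E x : fill (fun i => omap f (w i)) x = f \o fill w (g x).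
  by apply: funext => k; rewrite /fill /=; case: (w k) => //=; rewrite gK.
by move=> x y; rewrite !E.
Qed.

(** Color-focused lines over [option L]: each is monochromatic on the letters of [L], the colors are
    distinct, and all lines meet in [f] at the extra letter [None]. *)
Definition focused (I L : Type) (C : eqType) (chi : (I -> option L) -> C)
    (f : I -> option L) (s : seq ((I -> option (option L)) * C)) :=
  uniq (map snd s) /\ forall k, List.In k s ->
    [/\ exists i, k.1 i = None, fill k.1 None = f &
        forall x, chi (fill k.1 (Some x)) = k.2].

Lemma focused_mono (I L : Type) (C : eqType) (chi : (I -> option L) -> C) f s :
  focused chi f s -> chi f \in map snd s -> mono_line chi.
Proof.
move=> [_ Hs] fs.
have [k ks kf] : exists2 k, List.In k s & k.2 = chi f.
  elim: s fs {Hs} => //= k s IH; rewrite in_cons => /predU1P[->|/IH[k' ? ?]].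
    by exists k => //; left.
  by exists k' => //; right.
have [ik k0 k1] := Hs _ ks; exists k.1 => //.
have E z : chi (fill k.1 z) = chi f by case: z => [x|]; rewrite ?k1 ?k0 ?kf.
by move=> x y; rewrite !E.
Qed.

(** Hales-Jewett for [L], with the colorings of the block [I] as colors, yields a line in a new
    block [J] along which the letters of [L] are indistinguishable. *)
Lemma color_focusing (L C : finType) (x0 : L) : hales_jewett_for L -> forall n,
  exists I : finType, forall chi : (I -> option L) -> C,
    mono_line chi \/ exists f s, focused chi f s /\ size s = n.
Proof.
move=> HJ; elim=> [|n [I HI]].
  by exists unit => chi; right; exists (fun=> None), [::]; split=> //; split=> // k [].
have [J HJJ] := HJ {ffun {ffun I -> option L} -> C}.
exists (J + I)%type => chi.
pose up (u : J -> L) : J -> option L := fun j => Some (u j).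
have [w [j0 wj0] Hw] := HJJ (fun u => [ffun v : {ffun I -> option L} =>
   chi (juxt (up u) v)]).
have {}Hw x v : chi (juxt (up (fill w x)) v) = chi (juxt (up (fill w x0)) v).
  have /ffunP/(_ (finfun v)) := Hw x x0; rewrite !ffunE.
  by have -> : (finfun v : I -> _) = v by apply: funext => i; rewrite ffunE.
pose chi' v := chi (juxt (up (fill w x0)) v).
pose w' : J -> option (option L) := fun j => omap Some (w j).
have w'E x : fill w' (Some x) = up (fill w x).
  by apply: funext => j; rewrite /fill /w' /up; case: (w j).
have juxtE (u : J -> option (option L)) (v : I -> option (option L)) z :
    fill (juxt u v) z = juxt (fill u z) (fill v z).
  by apply: funext => -[].
have cst (T : Type) (u : T -> option L) z : fill (fun i => Some (u i)) z = u.
  by apply: funext => i.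
have lift_mono : mono_line chi' -> mono_line chi.
  move=> [v [i vi] Hv].
  exists (juxt (fun j => Some (up (fill w x0) j)) v); first by exists (inr i).
  by move=> x y; rewrite !juxtE !cst; exact: Hv.
have [/lift_mono|[f [s [Hs sn]]]] := HI chi'; first by left.
have [fs|fs] := boolP (chi' f \in map snd s).
  by left; apply/lift_mono/(focused_mono Hs fs).
right; exists (juxt (fill w' None) f).
exists ((juxt w' (fun i => Some (f i)), chi' f) ::
        map (fun k => (juxt w' k.1, k.2)) s); split; last by rewrite /= size_map sn.
case: Hs => us Hs; split.
  by rewrite /= -map_comp /= (eq_map (g := snd)) ?fs.
move=> k /= [<-|] /=.
  split; first by exists (inl j0); rewrite /= /w' wj0.
    by rewrite juxtE cst.
  by move=> x; rewrite juxtE cst w'E Hw.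
move=> /List.in_map_iff[k' [<- /Hs[_ k0 k1]]] /=; split.
- by exists (inl j0); rewrite /= /w' wj0.
- by rewrite juxtE k0.
- by move=> x; rewrite juxtE w'E Hw -/(chi' _) k1.
Qed.

(** With [#|C|] focused lines every color occurs, so the color of the focus is that of one of the
    lines. *)
Lemma hales_jewett_option (L : finType) :
  hales_jewett_for L -> hales_jewett_for (option L).
Proof.
move=> HJ C; have [/card0_eq L0|] := posnP #|L|.
  exists unit => chi; exists (fun=> None); first by exists tt.
  by case=> [x|]; [have := L0 x|case=> [x|//]; have := L0 x].
move=> /card_gt0P[x0 _].
have [I HI] := color_focusing C x0 HJ #|C|.
exists I => chi; have [//|[f [s [Hs sn]]]] := HI chi.
apply: (focused_mono Hs); case: Hs => us _.
have sC : {subset map snd s <= enum C} by move=> x _; rewrite mem_enum.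
have [|_ ->] := uniq_min_size us sC; last by rewrite mem_enum.
by rewrite size_map sn cardE.
Qed.

Theorem hales_jewett (L : finType) : hales_jewett_for L.
Proof.
have HJn n : hales_jewett_for 'I_n.
  elim: n => [|n /hales_jewett_option].
    move=> C; exists unit => chi; exists (fun=> None); first by exists tt.
    by case.
  have c : #|{: option 'I_n}| = n.+1 by rewrite card_option card_ord.
  apply: (@hales_jewett_bij _ _ (cast_ord c \o enum_rank)).
  exists (enum_val \o cast_ord (esym c)) => x /=.
    by rewrite cast_ordK enum_rankK.
  by rewrite enum_valK cast_ordKV.
apply: (hales_jewett_bij (f := enum_val) _ (HJn #|L|)).
by exists enum_rank; [exact: enum_valK|exact: enum_rankK].
Qed.

Definition homogeneous (C : Type) m (chi : seq nat -> C) (s : seq nat) :=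
  forall t t', subseq t s -> subseq t' s -> size t = m -> size t' = m ->
    chi t = chi t'.

(** Subsets are subsequences. Each element of the list [l] built in the proof alone decides the
    color of the subsets that it starts; the pigeonhole principle then makes these colors equal. *)
Theorem ramsey (m : nat) (C : finType) (d : nat) :
  exists p, forall (chi : seq nat -> C) (X : seq nat), p <= size X ->
    exists s, [/\ subseq s X, size s = d & homogeneous m chi s].
Proof.
elim: m d => [|m IH] d.
  exists d => chi X dX; exists (take d X); split; first exact: take_subseq.
    by rewrite size_takel.
  by move=> [|? ?] [|? ?].
have [c0|] := posnP #|C|.
  by exists 0 => chi; have := card0_eq c0 (chi [::]).
move=> /card_gt0P[c0 _].
(* Pairs (x, c): every (m+1)-subset with least element x has color c. *)
pose good chi := fix good (l : seq (nat * C)) := match l with [::] => True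
  | k :: l' => (forall t, subseq t (map fst l') -> size t = m ->
      chi (k.1 :: t) = k.2) /\ good l' end.
have H k : exists p, forall (chi : seq nat -> C) (X : seq nat), p <= size X ->
    exists l, [/\ subseq (map fst l) X, size l = k & good chi l].
  elim: k => [|k [p Hp]]; first by exists 0 => chi X _; exists [::]; rewrite sub0seq.
  have [q Hq] := IH p; exists q.+1 => chi [//|x X] /= qX.
  have [Y [YX Yp hY]] := Hq (fun t => chi (x :: t)) X qX.
  have [|l [lY lk gl]] := Hp chi Y; first by rewrite Yp.
  have [[t0 [t0l t0m]]|no] := pselect (exists t0, subseq t0 (map fst l) /\ size t0 = m).
    exists ((x, chi (x :: t0)) :: l); split; rewrite /= ?lk //.
      by rewrite eqxx (subseq_trans lY YX).
    by split=> // t tl tm; apply: hY; rewrite // (subseq_trans _ lY).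
  exists ((x, c0) :: l); split; rewrite /= ?lk //.
    by rewrite eqxx (subseq_trans lY YX).
  by split=> // t tl tm; case: no; exists t.
have [p Hp] := H (#|C| * d).+1; exists p => chi X /(Hp chi)[l [lX ls gl]].
have [c dc] : exists c, d <= count (fun k => k.2 == c) l.
  apply: contrapT => no; suff: size l <= #|C| * d by rewrite ls ltnn.
  have -> : size l = \sum_c count (fun k => k.2 == c) l.
    under eq_bigr do rewrite -sum1_count big_mkcond.
    rewrite exchange_big -sum1_size; apply: eq_bigr => k _.
    by rewrite -big_mkcond /= (big_pred1 k.2) // => c; rewrite eq_sym.
  rewrite -sum_nat_const; apply: leq_sum => c _; rewrite leqNgt; apply/negP => dc.
  by apply: no; exists c; exact: ltnW.
pose l' := [seq k <- l | k.2 == c].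
exists (take d (map fst l')); split.
- apply: subseq_trans (take_subseq _ _) (subseq_trans _ lX).
  exact/map_subseq/filter_subseq.
- by rewrite size_takel // size_map size_filter.
suff E t : subseq t (map fst l') -> size t = m.+1 -> chi t = c.
  move=> t t' st st' tm t'm; have tl : subseq (take d (map fst l')) (map fst l').
    exact: take_subseq.
  by rewrite (E t (subseq_trans st tl) tm) (E t' (subseq_trans st' tl) t'm).
rewrite /l' {ls lX dc l'}; elim: l gl t => [|[x c'] l IHl] /=; first by move=> _ [].
move=> [gx gl] [//|y t]; case: eqP => [e|_] /=; last exact: IHl.
case: eqP => [->|_]; last exact: IHl.
move=> tl [tm]; rewrite -e gx //; apply: subseq_trans tl _.
exact/map_subseq/filter_subseq.
Qed.

(** * The partite construction *)

Definition embedding r (V W : Type) (F : ('I_r -> V) -> Prop)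
    (F' : ('I_r -> W) -> Prop) (e : V -> W) : Prop :=
  injective e /\ forall t, F t <-> F' (e \o t).

(* For graphs, the [n]-tuples of pairwise distinct vertices spanning a clique. *)
Definition irreducible r (V : Type) (F : ('I_r -> V) -> Prop) n (f : 'I_n -> V) :=
  forall i j, i != j ->
    exists s : 'I_r -> 'I_n, [/\ exists a, s a = i, exists b, s b = j & F (f \o s)].

Definition in_class (N : nat -> Prop) r (V : Type) (F : ('I_r -> V) -> Prop) :=
  is_hypergraph F /\ forall n (f : 'I_n -> V), N n -> ~ irreducible F f.

Lemma embedding_id r V (F : ('I_r -> V) -> Prop) : embedding F F id.
Proof. by split. Qed.

Lemma embedding_comp r (U V W : Type) (F : ('I_r -> U) -> Prop)
    (F' : ('I_r -> V) -> Prop) (F'' : ('I_r -> W) -> Prop) e e' :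
  embedding F F' e -> embedding F' F'' e' -> embedding F F'' (e' \o e).
Proof. by move=> [ie He] [ie' He']; split=> [|t]; [exact: inj_comp|rewrite He He']. Qed.

Lemma in_class_pullback N r (V W : Type) (F : ('I_r -> W) -> Prop) (p : V -> W) :
  in_class N F -> in_class N (fun t : 'I_r -> V => F (p \o t)).
Proof.
move=> [[Finj Fperm] Ffree]; split; last first.
  by move=> n f Nn irr; apply: (Ffree n (p \o f)).
split=> [t /Finj /inj_compr //|t s bs]; exact: Fperm.
Qed.

(** Any two vertices of an irreducible substructure share an edge and no edge meets two copies, so
    it lies in a single copy. *)
Lemma in_class_copies N r (J U : Type) (good : J -> Prop) (D : ('I_r -> U) -> Prop) :
  (forall n, N n -> 2 <= n) -> in_class N D ->
  in_class N (fun t : 'I_r -> J * U =>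
    exists j t', [/\ good j, D t' & t = fun a => (j, t' a)]).
Proof.
move=> N2 [[Dinj Dperm] Dfree]; split.
  split=> [t [j [t' [_ /Dinj t'inj ->]]] a b [/t'inj] //|t s bs [j [t' [gj Dt' ->]]]].
  by exists j, (t' \o s); split=> //; exact: Dperm.
move=> n f Nn irr; have n2 := N2 _ Nn.
have n0 : 0 < n by exact: ltn_trans n2.
have f1 i : (f i).1 = (f (Ordinal n0)).1.
  have [->//|ne] := eqVneq i (Ordinal n0).
  have [s [[a <-] [b <-] [j [t' [_ _ E]]]]] := irr _ _ ne.
  by have Ea := congr1 (@^~ a) E; have Eb := congr1 (@^~ b) E; rewrite /= in Ea Eb;
    rewrite Ea Eb.
apply: (Dfree n (fun i => (f i).2) Nn) => i k /irr[s [si sk [j [t' [_ Dt' E]]]]].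
exists s; split=> //; suff -> : (fun i => (f i).2) \o s = t' by [].
by apply: funext => a; have /(congr1 snd) := congr1 (@^~ a) E.
Qed.

(** The alphabet consists of the copies of [A] in [F] over [h]. Each line carries a copy of [F],
    whose copies of [A] over [h] are the points of the line, so a monochromatic line is what is
    needed. *)
Lemma partite_step N r m (V B : finType) (F : ('I_r -> V) -> Prop)
    (FB : ('I_r -> B) -> Prop) (p : V -> B) (A : ('I_r -> 'I_m) -> Prop)
    (h : 'I_m -> B) :
  (forall n, N n -> 2 <= n) -> in_class N F -> in_class N A -> injective h ->
  (forall t, F t -> FB (p \o t)) ->
  ((exists n, N n) -> forall t, FB (h \o t) -> A t) ->
  exists (V' : finType) (F' : ('I_r -> V') -> Prop) (p' : V' -> B),
    [/\ in_class N F', forall t, F' t -> FB (p' \o t) &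
      forall chi : ('I_m -> V') -> bool, exists j, [/\ embedding F F' j,
        forall x, p' (j x) = p x & exists c, forall f, embedding A F f ->
          (forall i, p (f i) = h i) -> chi (j \o f) = c]].
Proof.
move=> N2 [[Finj Fperm] Ffree] [_ Afree] hinj Fhom hA.
pose L : finType :=
  {f : {ffun 'I_m -> V} | `[< embedding A F f /\ forall i, p (f i) = h i >]}.
have Lemb (l : L) : embedding A F (val l) by have /asboolP[] := valP l.
have [I HI] := hales_jewett L bool.
(* HJ-words over the parts of h, and for each template a private copy of the
   vertices of V outside these parts; the junk vertices are isolated. *)
pose V' : finType := ('I_m * {ffun I -> V} + {ffun I -> option L} * V)%type.
pose word (w : {ffun I -> option L}) i x : {ffun I -> V} :=
  [ffun u => if w u is Some l then val l i else x].
pose j w x : V' :=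
  if [pick i | h i == p x] is Some i then inl (i, word w i x) else inr (w, x).
pose p' (v : V') := match v with inl k => h k.1 | inr k => p k.2 end.
pose line (w : {ffun I -> option L}) := exists u, w u = None.
pose F' (t' : 'I_r -> V') := exists w t, [/\ line w, F t & t' = j w \o t].
have jin w x i : h i = p x -> j w x = inl (i, word w i x).
  rewrite /j => hx; case: pickP => [k /eqP|/(_ i)]; last by rewrite hx eqxx.
  by rewrite -hx => /hinj ->.
have jout w x : ~ (exists i, h i = p x) -> j w x = inr (w, x).
  by rewrite /j => no; case: pickP => // k /eqP hk; case: no; exists k.
have p'j w x : p' (j w x) = p x.
  by rewrite /j; case: pickP => // k /eqP.
have jinj w : line w -> injective (j w).
  move=> [u wu] x y e; have pxy : p x = p y by rewrite -(p'j w x) e p'j.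
  have [[i hi]|no] := pselect (exists i, h i = p x).
    move: e; rewrite (jin _ _ _ hi) (jin _ _ i) -?pxy // => -[/ffunP/(_ u)].
    by rewrite !ffunE wu.
  by move: e; rewrite jout // jout -?pxy // => -[].
(* Over h, two lines with disjoint sets of active coordinates only share copies
   of A, so the trace of one on the other is governed by A itself. *)
have jemb w : line w -> embedding F F' (j w).
  move=> lw; split; first exact: jinj.
  move=> t; split=> [Ft|[w2 [t2 [lw2 Ft2 e]]]]; first by exists w, t.
  have ea a : j w (t a) = j w2 (t2 a) by exact: (congr1 (@^~ a) e).
  have pa a : p (t a) = p (t2 a) by rewrite -(p'j w) ea p'j.
  have [[a na]|al] := pselect (exists a, ~ exists i, h i = p (t a)).
    have ww : w = w2 by move: (ea a); rewrite jout // jout -?pa // => -[].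
    suff -> : t = t2 by [].
    by apply: funext => b; apply: (jinj _ lw); rewrite ea ww.
  have /choice[io hio] a : exists i, h i = p (t a).
    by apply: contrapT => no; apply: al; exists a.
  have wa u a : word w (io a) (t a) u = word w2 (io a) (t2 a) u.
    by move: (ea a); rewrite (jin _ _ _ (hio a)) (jin _ _ (io a)) -?pa // => -[->].
  have [[u wu] [u2 wu2]] := (lw, lw2).
  have : t = t2 \/ exists l : L, t = val l \o io.
    case w2u: (w2 u) => [l|]; [right; exists l|left]; apply: funext => a.
      by have := wa u a; rewrite !ffunE wu w2u.
    by have := wa u a; rewrite !ffunE wu w2u.
  move=> [->//|[l tl]].
  have : t = t2 \/ exists l2 : L, t2 = val l2 \o io.
    case w2u: (w u2) => [l2|]; [right; exists l2|left]; apply: funext => a.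
      by have := wa u2 a; rewrite !ffunE wu2 w2u.
    by have := wa u2 a; rewrite !ffunE wu2 w2u.
  move=> [->//|[l2 t2l]]; rewrite tl.
  by apply/(Lemb l).2/(Lemb l2).2; rewrite -t2l.
exists V', F', p'; split.
- split.
    split=> [t [w [t' [lw /Finj t'inj ->]]]|t s bs [w [t' [lw Ft' ->]]]].
      by apply: inj_comp => //; exact: jinj.
    by exists w, (t' \o s); split=> //; exact: Fperm.
  move=> n f Nn irr; have n2 := N2 _ Nn.
  (* A vertex off the parts of [h] belongs to a single copy of [F], which then contains the whole
     irreducible substructure. If there is none, the projection to [h] is an irreducible
     substructure of [A]. *)
  have [[i0 [[w x] f0]]|al] := pselect (exists i k, f i = inr k).
    have fi i : i != i0 -> line w /\ exists y, f i = j w y /\ exists y0, f i0 = j w y0.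
      move=> /irr[s [[a sa] [b sb] [w' [t [lw' Ft e]]]]].
      have ea := congr1 (@^~ a) e; have eb := congr1 (@^~ b) e.
      rewrite /= sa in ea; rewrite /= sb in eb.
      have ww : w' = w by move: eb; rewrite f0 /j; case: pickP => // _ [].
      by rewrite -ww; split=> //; exists (t a); split=> //; exists (t b).
    have [i1 i10] : exists i1 : 'I_n, i1 != i0.
      have n0 : 0 < n by exact: ltn_trans n2.
      have [e0|] := eqVneq (Ordinal n0) i0; last by exists (Ordinal n0).
      by exists (Ordinal n2); rewrite -e0.
    have lw := (fi _ i10).1.
    have /choice[g gE] i : exists y, f i = j w y.
      have [->|ii0] := eqVneq i i0; last by have [_ [y [? _]]] := fi _ ii0; exists y.
      by have [_ [_ [_ [y0 ?]]]] := fi _ i10; exists y0.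
    apply: (Ffree n g Nn) => i k /irr[s [si sk Fs]]; exists s; split=> //.
    apply/(jemb w lw).2; suff -> : j w \o (g \o s) = f \o s by [].
    by apply: funext => a /=; rewrite gE.
  have /choice[io ioE] i : exists i', p' (f i) = h i'.
    case fi : (f i) => [[k y]|k]; first by exists k.
    by case: al; exists i, k.
  apply: (Afree n io Nn) => i k /irr[s [si sk [w [t [_ Ft e]]]]]; exists s; split=> //.
  apply: hA; first by exists n.
  suff -> : h \o (io \o s) = p \o t by exact: Fhom.
  apply: funext => a; have ea := congr1 (@^~ a) e; rewrite /= in ea.
  by rewrite /= -ioE ea p'j.
- move=> _ [w [t [_ /Fhom Ft ->]]]; suff -> : p' \o (j w \o t) = p \o t by [].
  by apply: funext => a; rewrite /= p'j.
move=> chi.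
(* A word of copies of [A] is transposed into a map from ['I_m]: vertex [i] goes to the word of the
   [i]-th vertices. *)
pose fw (u : I -> L) : 'I_m -> V' := fun i => inl (i, [ffun k => val (u k) i]).
have [w0 [u0 w0u] Hw] := HI (chi \o fw); pose w := finfun w0.
have lw : line w by exists u0; rewrite ffunE.
have jw (l : L) : j w \o val l = fw (fill w0 l).
  have hl i : h i = p (val l i) by have /asboolP[_ ->] := valP l.
  apply: funext => i /=; rewrite (jin _ _ i) // /fw; congr (inl (i, _)).
  by apply/ffunP => u; rewrite !ffunE /fill; case: (w0 u).
exists (j w); split=> //; first exact: jemb.
have ofL f : embedding A F f -> (forall i, p (f i) = h i) ->
    exists l : L, f = val l.
  move=> ef hf; have fE : (finfun f : 'I_m -> V) = f.
    by apply: funext => i; rewrite ffunE.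
  have Hf : `[< embedding A F (finfun f) /\ forall i, p (finfun f i) = h i >].
    by apply/asboolP; rewrite fE.
  by exists (Sub (finfun f) Hf); rewrite SubK fE.
have [[l0 _]|no] := pselect (exists l : L, True).
  exists (chi (j w \o val l0)) => f ef hf.
  by have [l ->] := ofL f ef hf; rewrite !jw; exact: Hw.
by exists true => f ef hf; have [l _] := ofL f ef hf; case: no; exists l.
Qed.

(** The coloring is treated in the order opposite to the construction: first the step added last,
    then its pullback along [j2] by the induction hypothesis. *)
Lemma partite_steps N r m (V B : finType) (F : ('I_r -> V) -> Prop)
    (FB : ('I_r -> B) -> Prop) (p : V -> B) (A : ('I_r -> 'I_m) -> Prop)
    (hs : seq {ffun 'I_m -> B}) :
  (forall n, N n -> 2 <= n) -> in_class N F -> in_class N A ->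
  (forall t, F t -> FB (p \o t)) ->
  (forall h : {ffun 'I_m -> B}, h \in hs -> injective h /\
    ((exists n, N n) -> forall t, FB (h \o t) -> A t)) ->
  exists (V' : finType) (F' : ('I_r -> V') -> Prop) (p' : V' -> B),
    [/\ in_class N F', forall t, F' t -> FB (p' \o t) &
      forall chi : ('I_m -> V') -> bool, exists j, [/\ embedding F F' j,
        forall x, p' (j x) = p x & forall h : {ffun 'I_m -> B}, h \in hs ->
          exists c, forall f, embedding A F f -> (forall i, p (f i) = h i) ->
            chi (j \o f) = c]].
Proof.
move=> N2 FN AN Fhom; elim: hs => [|h hs IH] Hhs.
  exists V, F, p; split=> // chi; exists id; split=> //; exact: embedding_id.
have [|V1 [F1 [p1 [F1N F1hom H1]]]] := IH.
  by move=> k khs; apply: Hhs; rewrite in_cons khs orbT.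
have [hinj hA] := Hhs h (mem_head _ _).
have [V2 [F2 [p2 [F2N F2hom H2]]]] := partite_step N2 F1N AN hinj F1hom hA.
exists V2, F2, p2; split=> // chi.
have [j2 [j2e p2j [c2 c2P]]] := H2 chi.
have [j1 [j1e p1j H]] := H1 (fun f => chi (j2 \o f)).
exists (j2 \o j1); split; first exact: embedding_comp j1e j2e.
  by move=> x /=; rewrite p2j p1j.
move=> k; rewrite in_cons => /predU1P[->|/H //]; exists c2 => f ef pf.
apply: (c2P (j1 \o f)); first exact: embedding_comp ef j1e.
by move=> i /=; rewrite p1j.
Qed.

Definition same_type m (f f' : 'I_m -> nat) :=
  forall i k, (f i < f k) = (f' i < f' k).

(** In the copy [e], colors depend only on order types for the natural order of ['I_d]. The
    predicate [good] tells which maps count as copies: injections at first, embeddings later. *)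
Definition order_ramsey r m d (A : ('I_r -> 'I_m) -> Prop)
    (D : ('I_r -> 'I_d) -> Prop) (V : Type) (good : ('I_d -> V) -> Prop) :=
  forall chi : ('I_m -> V) -> bool, exists2 e, good e &
    forall f f' : 'I_m -> 'I_d, embedding A D f -> embedding A D f' ->
      same_type f f' -> chi (e \o f) = chi (e \o f').

(** The initial picture has a separate copy of [D] over each good map to [B]. The partite steps make
    the color of a copy of [A] depend only on its projection to [B], where the Ramsey property of
    [B] applies. *)
Lemma partite_construction N r m d (B : finType) (FB : ('I_r -> B) -> Prop)
    (A : ('I_r -> 'I_m) -> Prop) (D : ('I_r -> 'I_d) -> Prop)
    (good : ('I_d -> B) -> Prop) (hs : ('I_m -> B) -> Prop) :
  (forall n, N n -> 2 <= n) -> in_class N A -> in_class N D ->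
  (forall e t, good e -> D t -> FB (e \o t)) ->
  (forall e f, good e -> embedding A D f -> hs (e \o f)) ->
  (forall h, hs h -> injective h /\
    ((exists n, N n) -> forall t, FB (h \o t) -> A t)) ->
  order_ramsey A D good ->
  exists (V : finType) (F : ('I_r -> V) -> Prop),
    in_class N F /\ order_ramsey A D (embedding D F).
Proof.
move=> N2 AN DN goodhom goodhs hsP HB.
pose V0 : finType := ({ffun 'I_d -> B} * 'I_d)%type.
pose F0 (t : 'I_r -> V0) := exists (j : {ffun 'I_d -> B}) t',
  [/\ good j, D t' & t = fun a => (j, t' a)].
have F0N : in_class N F0 by exact: (in_class_copies _ N2 DN).
pose p (x : V0) := x.1 x.2.
have F0hom t : F0 t -> FB (p \o t).
  by move=> [j [t' [gj Dt' ->]]]; exact: (goodhom j t').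
pose hl := [seq h <- enum {: {ffun 'I_m -> B}} | `[< hs (h : {ffun _}) >]].
have [|V [F [p' [FN Fhom H]]]] := partite_steps (hs := hl) N2 F0N AN F0hom.
  by move=> h; rewrite mem_filter => /andP[/asboolP/hsP].
exists V, F; split=> // chi.
have [j [je pj Hj]] := H chi.
have /choice[chiB chiBP] (h : {ffun 'I_m -> B}) : exists c, hs h ->
    forall f, embedding A F0 f -> (forall i, p (f i) = h i) -> chi (j \o f) = c.
  have [hh|no] := pselect (hs h); last by exists true.
  have [|c cP] := Hj h; first by rewrite mem_filter mem_enum andbT; apply/asboolP.
  by exists c.
have [e ge eP] := HB (fun h => chiB (finfun h)).
pose e0 (x : 'I_d) : V0 := (finfun e, x).
have finK (T : finType) (f : T -> B) : (finfun f : T -> B) = f.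
  by apply: funext => x; rewrite ffunE.
have e0e : embedding D F0 e0.
  split=> [x y [] //|t]; split=> [Dt|[j' [t' [_ Dt' E]]]].
    by exists (finfun e), t; rewrite finK.
  suff -> : t = t' by [].
  by apply: funext => a; have /(congr1 snd) := congr1 (@^~ a) E.
exists (j \o e0); first exact: embedding_comp e0e je.
have chiE f : embedding A D f -> chi (j \o e0 \o f) = chiB (finfun (e \o f)).
  move=> fe; apply: (chiBP _ _ (e0 \o f)).
  - by rewrite finK; exact: goodhs.
  - exact: embedding_comp fe e0e.
  - by move=> i; rewrite /p /= !ffunE.
by move=> f f' fe fe' ff'; rewrite !chiE //; exact: eP.
Qed.

(** * The Ramsey property with respect to orders *)

Lemma index_sorted (l : seq nat) x : sorted ltn l -> x \in l ->
  index x l = count (ltn^~ x) l.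
Proof.
elim: l => //= y l IH yl; rewrite in_cons eq_sym.
have /andP[/allP yal sl] : all (ltn y) l && sorted ltn l.
  by rewrite -(path_sortedE ltn_trans).
have [<- _|_ /= xl] := eqVneq y x.
  rewrite ltnn (eq_in_count (a2 := pred0)) ?count_pred0 // => z /yal /= yz.
  by rewrite ltnNge ltnW.
by rewrite IH //; have /= -> := yal _ xl.
Qed.

(** An injection is determined by its image and its ranks, and the ranks by its type. An [m]-subset
    is therefore colored by the colors of all its relabellings at once. *)
Lemma order_ramsey_ordinals r m d (A : ('I_r -> 'I_m) -> Prop)
    (D : ('I_r -> 'I_d) -> Prop) :
  exists p, order_ramsey A D (fun e : 'I_d -> 'I_p => injective e).
Proof.
have [p Hp] := ramsey m {ffun {ffun 'I_m -> 'I_m} -> bool} d.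
exists p.+1 => chi.
pose col (t : seq nat) : {ffun {ffun 'I_m -> 'I_m} -> bool} :=
  [ffun s : {ffun 'I_m -> 'I_m} => chi (fun i => inord (nth 0 t (s i)))].
have [|s [siota sd hs]] := Hp col (iota 0 p.+1); first by rewrite size_iota.
have sp i : i < d -> nth 0 s i < p.+1.
  move=> id; have /(mem_subseq siota) : nth 0 s i \in s by rewrite mem_nth ?sd.
  by rewrite mem_iota.
have us : uniq s by rewrite (subseq_uniq siota) ?iota_uniq.
pose e (i : 'I_d) : 'I_p.+1 := inord (nth 0 s i).
exists e.
  move=> i k /(congr1 val); rewrite /= !inordK ?sp // => /eqP.
  by rewrite nth_uniq ?sd // => /eqP/val_inj.
(* For injective [f], [im f] is the sorted image and [rk f i] the index of [f i] in it. *)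
pose im (f : 'I_m -> 'I_d) := [seq k <- iota 0 d | k \in map (val \o f) (enum 'I_m)].
pose rk (f : 'I_m -> 'I_d) i := count (fun k => f k < f i) (enum 'I_m).
have memim f i : val (f i) \in im f.
  by rewrite mem_filter mem_iota add0n /= ltn_ord andbT (map_f (val \o f)) ?mem_enum.
have imE f : injective f -> perm_eq (im f) (map (val \o f) (enum 'I_m)).
  move=> fi; apply: uniq_perm; first by rewrite filter_uniq ?iota_uniq.
    by rewrite map_inj_uniq ?enum_uniq //; exact: inj_comp val_inj fi.
  move=> k; rewrite mem_filter mem_iota andbC; case: (boolP (_ \in _)) => //=.
    by case/mapP => i _ ->; rewrite andbT add0n ltn_ord.
  by rewrite andbF.
have sim f : injective f -> size (im f) = m.
  by move=> /imE/perm_size ->; rewrite size_map size_enum_ord.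
have idx f i : injective f -> index (val (f i)) (im f) = rk f i.
  move=> fi; rewrite index_sorted ?memim //.
    by rewrite (permP (imE f fi)) count_map.
  by rewrite sorted_filter ?iota_ltn_sorted //; exact: ltn_trans.
have rkm f i : injective f -> rk f i < m.
  by move=> fi; rewrite -(sim f fi) -idx // index_mem memim.
have chiE f (rm : forall i, rk f i < m) : injective f ->
    chi (e \o f) = col (map (nth 0 s) (im f)) [ffun i => Ordinal (rm i)].
  move=> fi; rewrite ffunE; congr chi; apply: funext => i; rewrite ffunE /= /e.
  by rewrite (nth_map 0) -idx ?index_mem ?memim // nth_index ?memim.
have sub f : subseq (map (nth 0 s) (im f)) s.
  rewrite -{2}(mkseq_nth 0 s) sd; exact/map_subseq/filter_subseq.
move=> f f' [fi _] [fi' _] ff'.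
have rk' i : rk f i = rk f' i by apply: eq_count => k; exact: ff'.
have rm i : rk f i < m by exact: rkm.
have rm' i : rk f' i < m by exact: rkm.
have rr : [ffun i => Ordinal (rm i)] = [ffun i => Ordinal (rm' i)].
  by apply/ffunP => i; rewrite !ffunE; apply: val_inj; exact: rk'.
by rewrite (chiE f rm) // (chiE f' rm') // rr (hs _ (map (nth 0 s) (im f'))) ?size_map ?sim //.
Qed.

(** Two rounds. The first, over an ordinal with all tuples as edges, forbids nothing and yields
    embedded copies of [D]. The second, over [F1], works with transversals that embed [A], so no
    forbidden substructure arises over them. *)
Theorem class_order_ramsey N r m d (A : ('I_r -> 'I_m) -> Prop)
    (D : ('I_r -> 'I_d) -> Prop) :
  (forall n, N n -> 2 <= n) -> in_class N A -> in_class N D ->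
  exists (V : finType) (F : ('I_r -> V) -> Prop),
    in_class N F /\ order_ramsey A D (embedding D F).
Proof.
move=> N2 AN DN; have [p Hp] := order_ramsey_ordinals A D.
have hyp U (E : ('I_r -> U) -> Prop) : in_class N E -> in_class (fun=> False) E.
  by move=> [].
have [V1 [F1 [_ H1]]] : exists (V : finType) (F : ('I_r -> V) -> Prop),
    in_class (fun=> False) F /\ order_ramsey A D (embedding D F).
  apply: (partite_construction (FB := fun=> True) (hs := fun h => injective h) _
    (hyp _ _ AN) (hyp _ _ DN) _ _ _ Hp) => //.
    by move=> e f ei [fi _]; exact: inj_comp.
  by move=> h hi; split=> // -[].
apply: (partite_construction (FB := F1) (hs := embedding A F1) N2 AN DN _ _ _ H1).
- by move=> e t [_ eP] /eP.
- by move=> e f ee fe; exact: embedding_comp fe ee.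
- by move=> h [hi hP]; split=> // _ t /hP.
Qed.

(** * Limits of the classes and generic relations *)

(** A Fraisse limit; the age is stated for all finite types because the partite construction
    produces such types. *)
Definition is_limit (N : nat -> Prop) r (H : ('I_r -> nat) -> Prop) : Prop :=
  [/\ forall n, N n -> 2 <= n, in_class N H,
      forall (V : finType) (F : ('I_r -> V) -> Prop), in_class N F ->
        exists e : V -> nat, embedding F H e
    & hyp_ultrahomogeneous H].

Definition initial r (H : ('I_r -> nat) -> Prop) m : ('I_r -> 'I_m) -> Prop :=
  fun t => H (val \o t).

Definition generic_relation (G : set (nat -> nat)) (z : nat * nat -> bool) : Prop :=
  forall d (x : nat * nat -> bool), exists2 g, G g &
    forall i j, i < d -> j < d -> z (g i, g j) = x (i, j).

Section Automorphisms.
Variables (r : nat) (H : ('I_r -> nat) -> Prop).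
Local Notation G := (hyp_aut H).

Lemma hyp_aut_id : G id.
Proof. by split=> //; exists id. Qed.

Lemma hyp_aut_comp g g' : G g -> G g' -> G (g \o g').
Proof.
move=> [bg Hg] [bg' Hg']; split=> [|t]; first exact: bij_comp.
by rewrite Hg' Hg.
Qed.

Lemma hyp_aut_inv g : G g -> exists g', [/\ G g', cancel g g' & cancel g' g].
Proof.
move=> [[g' gK g'K] Hg]; exists g'; split=> //; split; first by exists g.
by move=> t; rewrite (Hg (g' \o t)); suff -> : g \o (g' \o t) = t by [];
  apply: funext => a /=.
Qed.

Lemma hyp_aut_embedding m g : G g -> embedding (initial H (m := m)) H (g \o val).
Proof.
move=> [/bij_inj gi Hg]; split; first by apply: inj_comp gi val_inj.
by move=> t; rewrite /initial Hg.
Qed.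

Lemma embedding_extends m (e : 'I_m -> nat) : hyp_ultrahomogeneous H ->
  embedding (initial H (m := m)) H e -> exists2 g, G g & forall i : 'I_m, g i = e i.
Proof.
move=> hom [ei eP].
pose p k := oapp e 0 (insub k).
have pE (i : 'I_m) : p i = e i by rewrite /p valK.
have [| | |g [Gg gP]] := hom `I_m p.
- exact: finite_II.
- move=> x y; rewrite !inE /= => xm ym.
  by rewrite (pE (Ordinal xm)) (pE (Ordinal ym)) => /ei [].
- move=> t tm; pose t' a := Ordinal (tm a).
  have -> : t = val \o t' by [].
  rewrite -/(initial H t') eP; suff -> : e \o t' = p \o (val \o t') by [].
  by apply: funext => a /=; rewrite (pE (t' a)).
by exists g => // i; rewrite gP ?pE //=.
Qed.

End Automorphisms.

Section Limit.
Variables (N : nat -> Prop) (r : nat) (H : ('I_r -> nat) -> Prop).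
Hypothesis HN : is_limit N H.
Local Notation G := (hyp_aut H).

Lemma initial_in_class m : in_class N (initial H (m := m)).
Proof. by case: HN => _ HC _ _; exact: in_class_pullback. Qed.

(** A finite Ramsey structure embeds in [H]; by homogeneity the good copy of [0, d) in it is the
    image of [0, d) under an automorphism. *)
Lemma limit_order_ramsey m d (chi : ('I_m -> nat) -> bool) :
  exists2 g0, G g0 & forall g g', G g -> G g' ->
    (forall i : 'I_m, g i < d) -> (forall i : 'I_m, g' i < d) ->
    same_type (fun i : 'I_m => g i) (fun i : 'I_m => g' i) ->
    chi (g0 \o (g \o val)) = chi (g0 \o (g' \o val)).
Proof.
have [N2 HC Hage hom] := HN.
have [V [F [FN HF]]] := class_order_ramsey N2 (initial_in_class m) (initial_in_class d).
have [e eF] := Hage V F FN.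
have [e1 e1F He1] := HF (fun f => chi (e \o f)).
have [g0 Gg0 g0E] := embedding_extends hom (embedding_comp e1F eF).
exists g0 => // g g' Gg Gg' gd gd' gg'.
have emb k (Gk : G k) (kd : forall i : 'I_m, k i < d) :
    embedding (initial H (m := m)) (initial H (m := d)) (fun i => Ordinal (kd i)).
  have [ki Hk] := hyp_aut_embedding m Gk; split; last exact: Hk.
  by move=> i j [] /ki.
have chiE (k : nat -> nat) (kd : forall i : 'I_m, k i < d) :
    g0 \o (k \o val) = e \o (e1 \o (fun i : 'I_m => Ordinal (kd i))).
  by apply: funext => i; exact: (g0E (Ordinal (kd i))).
by rewrite (chiE g gd) (chiE g' gd'); apply: He1 => //; exact: emb.
Qed.

(** Of [n.+1] disjoint copies, one must avoid the [n] vertices below [n]. *)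
Lemma exists_far_copy d n : exists2 g, G g & forall i, i < d -> n <= g i.
Proof.
have [N2 _ Hage hom] := HN.
have [e [ei eP]] := Hage _ _ (in_class_copies (fun _ : 'I_n.+1 => True) N2
  (initial_in_class d)).
have [k kn] : exists k : 'I_n.+1, forall i : 'I_d, n <= e (k, i).
  apply: contrapT => no.
  have /choice[f fP] (k : 'I_n.+1) : exists i : 'I_d, e (k, i) < n.
    apply: contrapT => nok; apply: no; exists k => i; rewrite leqNgt.
    by apply/negP => ?; apply: nok; exists i.
  suff /leq_card : injective (fun k => Ordinal (fP k)) by rewrite !card_ord ltnn.
  by move=> k k' [] /ei[].
have [|g Gg gE] := @embedding_extends _ _ d (fun i => e (k, i)) hom.
  split=> [i j /ei[] //|t]; rewrite -[H _]/(H (e \o (fun a => (k, t a)))) -eP.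
  split=> [Ht|[k' [t' [_ Ht' E]]]]; first by exists k, t.
  suff -> : t = t' by [].
  by apply: funext => a; have /(congr1 snd) := congr1 (@^~ a) E.
by exists g => // i id; rewrite (gE (Ordinal id)).
Qed.

(** All finite patterns are enumerated and planted on pairwise disjoint copies of initial
    segments. *)
Lemma exists_generic : exists z, generic_relation G z.
Proof.
pose pat := {d : nat & {ffun 'I_d * 'I_d -> bool}}.
pose dim k := if unpickle k is Some p then tag (p : pat) else 0.
have /choice[far farP] (q : nat * nat) :
    exists g, G g /\ forall i, i < dim q.1 -> q.2 <= g i.
  by have [g Gg gP] := exists_far_copy (dim q.1) q.2; exists g.
(* [bound k] is above all vertices used before stage [k]; a number that codes no pattern uses
   none. *)
pose fix bound k := if k is k'.+1 then
  maxn (bound k') (\max_(i < dim k') (far (k', bound k') i).+1) else 0.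
pose cp k := far (k, bound k).
have bmono k k' : k <= k' -> bound k <= bound k'.
  elim: k' => [|k' IH]; first by rewrite leqn0 => /eqP ->.
  rewrite leq_eqVlt => /predU1P[->//|/IH]; rewrite /= => bk.
  exact: leq_trans bk (leq_maxl _ _).
have cpub k i : i < dim k -> cp k i < bound k.+1.
  move=> id; rewrite /= leq_max; apply/orP; right.
  exact: (leq_bigmax (Ordinal id)).
have cplb k i : i < dim k -> bound k <= cp k i by have [_] := farP (k, bound k); apply.
have cpinj k k' i i' : i < dim k -> i' < dim k' -> cp k i = cp k' i' -> k = k' /\ i = i'.
  move=> id id' e.
  have kk' : k = k'.
    apply/eqP; rewrite eqn_leq (leqNgt k) (leqNgt k'); apply/andP; split; apply/negP => lt.
      have := leq_trans (cpub _ _ id') (leq_trans (bmono _ _ lt) (cplb _ _ id)).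
      by rewrite e ltnn.
    have := leq_trans (cpub _ _ id) (leq_trans (bmono _ _ lt) (cplb _ _ id')).
    by rewrite e ltnn.
  split=> //; move: e; rewrite -kk'.
  by have [[/bij_inj inj _] _] := farP (k, bound k); exact: inj.
pose z (q : nat * nat) := `[< exists k (p : pat) (i j : 'I_(tag p)),
  [/\ unpickle k = Some p, q = (cp k i, cp k j) & tagged p (i, j)] >].
exists z => d x; pose p : pat := Tagged _ [ffun ij : 'I_d * 'I_d => x (val ij.1, val ij.2)].
have dp : dim (pickle p) = d by rewrite /dim pickleK.
exists (cp (pickle p)); first by have [] := farP (pickle p, bound (pickle p)).
move=> i j id jd; apply/asboolP/idP => [[k [p' [i' [j' [kp' [ei ej] p'ij]]]]]|xij].
  have dk : dim k = tag p' by rewrite /dim kp'.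
  have [|||pk ii'] := cpinj (pickle p) k i i'; rewrite ?dp ?dk //.
  have [|||_ jj'] := cpinj (pickle p) k j j'; rewrite ?dp ?dk //.
  move: kp' i' j' ei ej p'ij ii' jj' {dk}; rewrite -pk pickleK => -[<-] i' j' _ _.
  by rewrite /= ffunE /= => xij -> ->.
exists (pickle p), p, (Ordinal id), (Ordinal jd); split=> //; first by rewrite pickleK.
by rewrite /= ffunE.
Qed.

Definition star (m n : nat) (a : 'I_n -> nat) (b : {ffun 'I_n -> bool} -> nat)
    (c : 'I_m -> nat) j w (i : 'I_m) : nat :=
  if val i == 0 then a j else if val i == 1 then b w else c i.

(** Adding [n] twins of vertex 0 and [2 ^ n] twins of vertex 1 to [0, m) stays in the class, and
    every choice of one twin each gives a copy of [0, m). Genericity then prescribes [z] on the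
    twins. *)
Lemma generic_shatters z m n : 2 <= m -> generic_relation G z ->
  exists (a : 'I_n -> nat) (b : {ffun 'I_n -> bool} -> nat) (c : 'I_m -> nat),
    forall j w, z (a j, b w) = w j /\
      exists2 g, G g & forall i : 'I_m, g i = star a b c j w i.
Proof.
case: m => [|[|m]] // _ zgen; have [N2 HC Hage hom] := HN.
pose V : finType := ('I_n + {ffun 'I_n -> bool} + 'I_m.+2)%type.
pose p (v : V) : 'I_m.+2 := match v with
  inl (inl _) => ord0 | inl (inr _) => Ordinal (isT : 1 < m.+2) | inr i => i end.
have [e [ei eP]] := Hage _ _ (in_class_pullback p (initial_in_class m.+2)).
pose a j := e (inl (inl j)); pose b w := e (inl (inr w)); pose c i := e (inr i).
pose d := \max_v (e v).+1.
have ed v : e v < d by exact: (leq_bigmax v).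
pose x q := `[< exists j w, [/\ q.1 = a j, q.2 = b w & w j] >].
have [g0 Gg0 g0E] := zgen d x.
exists (g0 \o a), (g0 \o b), (g0 \o c) => j w; split.
  rewrite g0E ?ed //; apply/asboolP/idP => [[j' [w' [/ei[->] /ei[->]]]] //|wj].
  by exists j, w.
pose sec (i : 'I_m.+2) : V := if val i == 0 then inl (inl j) else
  if val i == 1 then inl (inr w) else inr i.
have psec i : p (sec i) = i.
  by rewrite /sec; case: eqP => [i0|_]; [|case: eqP => // i1]; apply: val_inj.
have [|g Gg gE] := @embedding_extends _ _ _ (e \o sec) hom.
  split; first by apply: inj_comp => // i k eik; rewrite -(psec i) eik.
  move=> t; rewrite -[e \o sec \o t]/(e \o (sec \o t)) -eP.
  by suff -> : p \o (sec \o t) = t by []; apply: funext => i /=.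
exists (g0 \o g); first exact: hyp_aut_comp.
by move=> i; rewrite /= gE /star /= /sec; case: eqP => // _; case: eqP.
Qed.

End Limit.

(** * Positions with respect to finitely many orders *)

Lemma card_lt_inj (T : finType) (f : T -> nat) x y :
  #|[pred v | f v < x]| = #|[pred v | f v < y]| ->
  forall v, (f v < x) = (f v < y).
Proof.
wlog xy : x y / x <= y => [hw|].
  by have [/hw //|/ltnW yx e v] := leqP x y; apply/esym/hw.
(* These sets increase with the bound, so equal sizes force equality. *)
move=> e v; have s : [pred v | f v < x] \subset [pred v | f v < y].
  by apply/fintype.subsetP => u; rewrite !inE => /leq_trans; apply.
by have /(subset_cardP e)/(_ v) := s; rewrite !inE.
Qed.

Lemma card_gt_inj (T : finType) (f : T -> nat) x y :
  #|[pred v | x < f v]| = #|[pred v | y < f v]| ->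
  forall v, (x < f v) = (y < f v).
Proof.
wlog xy : x y / x <= y => [hw|].
  by have [/hw //|/ltnW yx e v] := leqP x y; apply/esym/hw.
move=> e v; have s : [pred v | y < f v] \subset [pred v | x < f v].
  by apply/fintype.subsetP => u; rewrite !inE; apply: leq_ltn_trans.
by have /(subset_cardP (esym e))/(_ v) := s; rewrite !inE.
Qed.

Lemma exp_beats_polynomial c k : exists n, ((n + c) ^ 2) ^ k < 2 ^ n.
Proof.
(* The witness makes [n + c = 2 ^ s], so that the left side is [2 ^ (s * 2 * k)]; the choice of [s]
   ensures [s * 2 * k + c < 2 ^ s]. *)
pose t := 4 * k + c; pose s := t + t.
have tt u : u < 2 ^ u by exact: ltn_expl.
have big : s * 2 * k + c < 2 ^ s.
  have := leq_mul (tt t) (tt t); rewrite -expnD -/s /t; nia.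
exists (2 ^ s - c).
rewrite subnK; last by lia.
rewrite -!expnM ltn_exp2l //; lia.
Qed.

(** Each order puts a vertex [b w] in one of polynomially many positions, so two of these [2 ^ n]
    vertices are not separated by any of the orders. For [j] with [w j != w' j] they yield copies of
    the same type with different values of [z]. *)
Lemma generic_not_order_determined N r (H : ('I_r -> nat) -> Prop) z m (K : finType) :
  is_limit N H -> generic_relation (hyp_aut H) z -> 2 <= m ->
  ~ forall d, exists rho : K -> nat -> nat, forall g g',
    hyp_aut H g -> hyp_aut H g' ->
    (forall i : 'I_m, g i < d) -> (forall i : 'I_m, g' i < d) ->
    (forall l, same_type (fun i : 'I_m => rho l (g i)) (fun i : 'I_m => rho l (g' i))) ->
    z (g 0, g 1) = z (g' 0, g' 1).
Proof.
move=> HN zgen m2 det.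
have [n hn] := exp_beats_polynomial (m + 1) #|K|.
have [a [b [c abc]]] := generic_shatters HN n m2 zgen.
pose T : finType := ('I_n + 'I_m)%type.
pose pt (v : T) := match v with inl j => a j | inr i => c i end.
pose d := maxn (\max_v (pt v).+1) (\max_w (b w).+1).
have ptd v : pt v < d by rewrite leq_max (leq_bigmax v).
have bd w : b w < d by rewrite leq_max (leq_bigmax w) orbT.
have [rho rhoP] := det d.
have cT (P : pred T) : #|P| < n + (m + 1).
  by rewrite addnA addn1 ltnS; apply: leq_trans (max_card _) _; rewrite card_sum !card_ord.
(* The points below and those above [b w] are both counted, since [rho l] may have ties. Counts run
   from 0 to [n + m]. *)
pose prof w : {ffun K -> 'I_(n + (m + 1)) * 'I_(n + (m + 1))} :=
  [ffun l => (Ordinal (cT [pred v | rho l (pt v) < rho l (b w)]),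
              Ordinal (cT [pred v | rho l (b w) < rho l (pt v)]))].
have [w [w' [ww' e]]] : exists w w', w != w' /\ prof w = prof w'.
  apply: contrapT => no; suff /leq_card : injective prof.
    by rewrite !card_ffun card_prod !card_ord card_bool leqNgt mulnn hn.
  move=> w w' e; apply/eqP; apply: contrapT => /negP ww'.
  by apply: no; exists w, w'.
have /existsP[j wj] : [exists j, w j != w' j].
  rewrite -negb_forall; apply: contra ww' => /forallP ww'.
  by apply/eqP/ffunP => j; exact/eqP.
have [zj [g Gg gE]] := abc j w; have [zj' [g' Gg' gE']] := abc j w'.
have lt0 : 0 < m by exact: ltn_trans m2.
have g0 : g 0 = a j := gE (Ordinal lt0); have g1 : g 1 = b w := gE (Ordinal m2).
have g0' : g' 0 = a j := gE' (Ordinal lt0); have g1' : g' 1 = b w' := gE' (Ordinal m2).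
suff : z (g 0, g 1) = z (g' 0, g' 1).
  by rewrite g0 g1 g0' g1' zj zj' => /eqP; rewrite (negPf wj).
have sd w1 i : star a b c j w1 i < d.
  rewrite /star; case: eqP => _; first exact: (ptd (inl j)).
  by case: eqP => _ //; exact: (ptd (inr i)).
apply: rhoP => // [i|i|l i k]; rewrite ?gE ?gE' //.
have /ffunP/(_ l) := e; rewrite !ffunE => -[/card_lt_inj lt /card_gt_inj gt].
rewrite /star; case: eqP => _; case: eqP => _ //; case: eqP => _ //.
- exact: (lt (inl j)).
- exact: (gt (inl j)).
- by case: eqP => _; [rewrite !ltnn|exact: (gt (inr k))].
- by case: eqP => _ //; exact: (lt (inr i)).
Qed.

(** * The groups of the theorem *)

Definition pair2 (T : Type) (x y : T) : 'I_2 -> T := fun i => if val i == 0 then x else y.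

Lemma pair2_eta T (t : 'I_2 -> T) : pair2 (t ord0) (t ord_max) = t.
Proof.
apply: funext => i; rewrite /pair2; case: eqP => i0; congr t; apply: val_inj => //=.
by case: i i0 => -[|[|]].
Qed.

Lemma pair2_comp T U (f : T -> U) x y : f \o pair2 x y = pair2 (f x) (f y).
Proof. by apply: funext => i; rewrite /pair2 /=; case: eqP. Qed.

Lemma irreducible_pair2 (V : Type) (F : ('I_2 -> V) -> Prop) n (f : 'I_n -> V) :
  (forall x y, F (pair2 x y) -> F (pair2 y x)) ->
  irreducible F f <-> forall i j, i != j -> F (pair2 (f i) (f j)).
Proof.
move=> symF; split=> irr i j ij; last first.
  exists (pair2 i j); split; [by exists ord0|by exists ord_max|].
  by rewrite pair2_comp; exact: irr.
have [s [[a sa] [b sb]]] := irr i j ij; rewrite -(pair2_eta (f \o s)) /=.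
have o2 (k : 'I_2) : k = ord0 \/ k = ord_max.
  by case: k => -[|[|//]] lt; [left|right]; apply: val_inj.
case: (o2 a) sa => ->; case: (o2 b) sb => -> sb sa.
- by rewrite -sa -sb eqxx in ij.
- by rewrite sa sb.
- by rewrite sa sb => /symF.
- by rewrite -sa -sb eqxx in ij.
Qed.

Lemma graph_in_class (N : nat -> Prop) (V : Type) (E : V -> V -> Prop) :
  is_graph E -> (forall n, N n -> Kn_free n E) ->
  in_class N (fun t : 'I_2 -> V => E (t ord0) (t ord_max)).
Proof.
move=> [symE irrE] free; split.
  split=> [t Et|t s bs Et].
    rewrite -(pair2_eta t) => i j; rewrite /pair2.
    case: eqP => i0; case: eqP => j0 e; apply: val_inj; rewrite ?i0 ?j0 //.
    - by case: (irrE (t ord0)); rewrite {2}e.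
    - by case: (irrE (t ord0)); rewrite -{2}e.
    by case: i j i0 j0 {e} => -[|[|]] // ? [] [|[|]].
  rewrite /=; have ne : s ord0 != s ord_max by rewrite (inj_eq (bij_inj bs)).
  have o2 (k : 'I_2) : k = ord0 \/ k = ord_max.
    by case: k => -[|[|//]] lt; [left|right]; apply: val_inj.
  move: ne; case: (o2 (s ord0)) => ->; case: (o2 (s ord_max)) => -> //.
  by move=> _; exact: symE.
move=> n f Nn /irreducible_pair2 irr; apply: (free n Nn).
have fE i j : i != j -> E (f i) (f j) by apply: irr => x y; exact: symE.
exists f; split=> // i j e; apply/eqP; apply: contrapT => /negP/fE.
by rewrite e; exact: irrE.
Qed.

Lemma age_ordinals (N : nat -> Prop) r (H : ('I_r -> nat) -> Prop) :
  (forall m (F : ('I_r -> 'I_m) -> Prop), in_class N F ->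
    exists e : 'I_m -> nat, embedding F H e) ->
  forall (V : finType) (F : ('I_r -> V) -> Prop), in_class N F ->
    exists e : V -> nat, embedding F H e.
Proof.
move=> H' V F FN; have [e ee] := H' _ _ (in_class_pullback (@enum_val V V) FN).
exists (e \o enum_rank); apply: embedding_comp ee; split; first exact: enum_rank_inj.
move=> t; suff -> : enum_val \o (enum_rank \o t) = t by [].
by apply: funext => a /=; rewrite enum_rankK.
Qed.

(** At each new point [x], the transposition of [g x] and [p x] corrects the bijection without
    changing the earlier values. *)
Lemma finite_injection_extends (A : set nat) (p : nat -> nat) : finite_set A ->
  {in A &, injective p} -> exists2 g : nat -> nat, bijective g & forall x, A x -> g x = p x.
Proof.
move=> /finite_seqP[s ->]; elim: s => [|x s IH] pinj.
  by exists id => //; exists id.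
have [|g gb gp] := IH.
  by move=> a b; rewrite !inE /= => sa sb; apply: pinj; rewrite inE /= in_cons ?sa ?sb orbT.
pose swap n := if n == g x then p x else if n == p x then g x else n.
have swapK : involutive swap.
  move=> n; rewrite /swap; case: (eqVneq n (g x)) => [->|ng].
    by case: eqVneq => [->//|_]; rewrite eqxx.
  case: (eqVneq n (p x)) => [->|np]; first by rewrite eqxx.
  by rewrite (negPf ng) (negPf np).
exists (swap \o g); first by apply: bij_comp => //; exists swap.
move=> a; rewrite /= in_cons /swap => /predU1P[->|sa]; first by rewrite eqxx.
case: eqVneq => [/(bij_inj gb) ->//|ax]; rewrite (gp a sa).
case: eqVneq => // /pinj e; rewrite e ?eqxx // in ax; rewrite inE /= in_cons ?eqxx //.
by rewrite sa orbT.
Qed.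

Lemma Sym_nat_limit : exists N (H : ('I_2 -> nat) -> Prop),
  is_limit N H /\ Sym_nat = hyp_aut H.
Proof.
exists (fun n => n = 2), (fun=> False); split; last first.
  by apply/seteqP; split=> g /=; [split|case].
split; first by move=> n ->.
- split=> // n f n2; move: f; rewrite n2 => f irr.
  by have [//|s []] := irr ord0 ord_max.
- move=> V F [_ Ffree]; exists (val \o enum_rank); split.
    by apply: inj_comp; [exact: val_inj|exact: enum_rank_inj].
  (* A tuple of [F] is itself an irreducible substructure of the forbidden size 2. *)
  move=> t; split=> // Ft; apply: (Ffree 2 t erefl) => i j _.
  by exists id; split=> //; [exists i|exists j].
- move=> A p fA pinj _; have [g gb gp] := finite_injection_extends fA pinj.
  by exists g.
Qed.

Lemma random_Kn_free_graph_limit n E : 3 <= n -> random_Kn_free_graph n E ->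
  exists N (H : ('I_2 -> nat) -> Prop), is_limit N H /\ graph_aut E = hyp_aut H.
Proof.
move=> n3 [grE freeE ageE homE].
pose H (t : 'I_2 -> nat) := E (t ord0) (t ord_max).
have GH : graph_aut E = hyp_aut H.
  apply/seteqP; split=> g [bg gE]; split=> //; first by move=> t; exact: gE.
  by move=> x y; exact: (gE (pair2 x y)).
exists (fun k => k = n), H; split=> //; split.
- by move=> _ ->; exact: ltnW.
- by apply: graph_in_class => // _ ->.
- apply: age_ordinals => m F [[Finj Fperm] Ffree].
  have symF x y : F (pair2 x y) -> F (pair2 y x).
    move=> Fxy; have -> : pair2 y x = pair2 x y \o @rev_ord 2.
      by apply: funext => -[[|[|]]] //.
    by apply: Fperm => //; exists (@rev_ord 2); exact: rev_ordK.
  have [| |e [ei eP]] := ageE m (fun x y => F (pair2 x y)).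
  + by split=> // x /Finj/(_ ord0 ord_max erefl).
  + by move=> [f [_ fE]]; apply: (Ffree n f erefl); exact/irreducible_pair2.
  + exists e; split=> // t; rewrite -{1}(pair2_eta t); exact: eP.
- move=> A p fA pinj pH; rewrite -GH; apply: homE => // x y Ax Ay.
  by apply: (pH (pair2 x y)) => i; rewrite /pair2; case: eqP.
Qed.

Lemma random_hypergraph_limit r (H : ('I_r -> nat) -> Prop) :
  random_hypergraph H -> is_limit (fun=> False) H.
Proof.
move=> [hypH ageH homH]; split=> //; apply: age_ordinals => m F [/ageH[e [ei eP]] _].
by exists e.
Qed.

Lemma theorem_group_limit G : theorem_group G ->
  exists N r (H : ('I_r -> nat) -> Prop), is_limit N H /\ G = hyp_aut H.
Proof.
case=> [->|[[n [E [n3 [/(random_Kn_free_graph_limit n3)]]]]|[r [H [_ [HH ->]]]]]].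
- by have [N [H]] := Sym_nat_limit; exists N, 2, H.
- by move=> [N [H [HN EH]]] ->; exists N, 2, H.
- by exists (fun=> False), r, H; split=> //; exact: random_hypergraph_limit.
Qed.

(** * Minimal flows *)

Lemma ptws_cvg (U : Type) (V : topologicalType) (F : set_system (U -> V)) (f : U -> V) :
  Filter F -> (forall u O, nbhs (f u) O -> F [set g | O (g u)]) ->
  F --> (f : {ptws U -> V}).
Proof.
move=> FF H; apply/cvg_sup => u A [B [[C oC <-] Cf] BA].
apply: (filterS BA); apply: H; apply: open_nbhs_nbhs; split=> //.
Qed.

Lemma ptws_nbhs (U : Type) (V : topologicalType) (f : {ptws U -> V}) u O :
  nbhs (f u) O -> nbhs f [set g : {ptws U -> V} | O (g u)].
Proof.
move=> fO; have /cvg_sup/(_ u) : nbhs f --> f by [].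
apply; rewrite nbhsE in fO; case: fO => C [oC Cf] CO.
by exists ((fun g : U -> V => g u) @^-1` C); split=> //; [exists C|move=> g /CO].
Qed.

(** The cylinders around [x] generate the filter [F]; its convergence to [x] is the claim. *)
Lemma ptws_discrete_nbhs (U : eqType) (V : discreteTopologicalType)
    (x : {ptws U -> V}) A :
  nbhs x A -> exists l : seq U, forall y : U -> V, {in l, y =1 x} -> A y.
Proof.
pose F : set_system (U -> V) :=
  [set B | exists l : seq U, forall y : U -> V, {in l, y =1 x} -> B y].
have FF : Filter F.
  split; first by exists [::].
    move=> P Q [l lP] [k kQ]; exists (l ++ k) => y yx; split.
      by apply: lP => i il; apply: yx; rewrite mem_cat il.
    by apply: kQ => i ik; apply: yx; rewrite mem_cat ik orbT.
  by move=> P Q PQ [l lP]; exists l => y /lP/PQ.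
apply: (ptws_cvg FF) => u O /nbhs_singleton Ox; exists [:: u] => y yx /=.
by rewrite yx ?mem_head.
Qed.

Lemma ptws_nat_nbhs (V : discreteTopologicalType) (x : {ptws nat -> V}) A :
  nbhs x A -> exists m, forall y : nat -> V, (forall i, (i < m)%N -> y i = x i) -> A y.
Proof.
move=> /ptws_discrete_nbhs[l lA]; exists (\max_(i <- l) i.+1) => y yx.
by apply: lA => i il; apply: yx; exact: (leq_bigmax_seq _ il).
Qed.

(** For a group [G] this yields: if [g] and [g'] agree on [0, m) and [act x g] is in [P], then
    [act x g'] is in [Q]. *)
Definition rigid (G : set (nat -> nat)) (M : topologicalType)
    (act : M -> (nat -> nat) -> M) m (P Q : set M) : Prop :=
  [/\ open P, closed Q & forall x k, P x -> G k ->
    (forall i, (i < m)%N -> k i = i) -> Q (act x k)].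

Section Flow.
Variables (G : set (nat -> nat)) (M : topologicalType) (act : M -> (nat -> nat) -> M).
Hypothesis flowM : is_flow G act.

Lemma act_continuous_at x k : G k ->
  (fun p : M * {ptws nat -> nat} => act p.1 p.2) @
    within [set p | G p.2] (nbhs (x, k : {ptws nat -> nat})) --> act x k.
Proof.
case: flowM => _ _ _ _ /subspace_continuousP/(_ (x, k)) H Gk.
have -> : [set p : M * {ptws nat -> nat} | G p.2] = [set: M] `*` G.
  by apply/seteqP; split=> [p Gp|p []].
exact: H.
Qed.

Lemma act_continuous k : G k -> continuous (act^~ k).
Proof.
move=> Gk x O /(act_continuous_at Gk); rewrite /= /within /= => -[[A B] /= [xA kB] AB].
apply: filterS xA => y Ay; apply: (AB (y, k)); first by split=> //; exact: nbhs_singleton kB.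
exact: Gk.
Qed.

(** Regularity of [M] yields [Q]; continuity of the action at [(x, id)] yields [P] and [m]. *)
Lemma rigid_exists x O : G id -> nbhs x O ->
  exists m P Q, [/\ rigid G act m P Q, P x & Q `<=` O].
Proof.
move=> Gid xO; have [cM hM act1 _ _] := flowM.
have [R xR RO] := compact_regular hM cM filterT xO.
have xR' : nbhs (act x id) R by rewrite act1.
have [[A B] /= [xA kB] AB] := act_continuous_at Gid xR'.
have [m mB] := ptws_nat_nbhs kB.
exists m, (A^°), (closure R); split=> //; split.
- exact: open_interior.
- exact: closed_closure.
- move=> y k /interior_subset Ay Gk km; apply: subset_closure.
  by apply: (AB (y, k)) => //; split=> //; exact: mB.
Qed.

End Flow.

Lemma compact_decreasing (X : topologicalType) (R : nat -> set X) :
  compact [set: X] -> (forall d, closed (R d)) -> (forall d, R d !=set0) ->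
  (forall d d', (d <= d')%N -> R d' `<=` R d) -> exists x, forall d, R d x.
Proof.
move=> cX cR /choice[u uR] decR.
have [|x [_ xu]] := cX (u @ \oo) _; first exact: filterT.
exists x => d; apply: cR => B xB.
have [] := xu (R d) B _ xB; last by move=> y ?; exists y.
by exists d => // n /= /decR; apply; exact: uR.
Qed.

(** The points for which such orders exist for all [d] form a closed invariant set, nonempty by the
    Ramsey property and compactness; minimality makes it all of [M]. *)
Lemma minimal_flow_tame N r (H : ('I_r -> nat) -> Prop) (M : topologicalType)
    (act : M -> (nat -> nat) -> M) m P Q :
  is_limit N H -> minimal_flow (hyp_aut H) act -> rigid (hyp_aut H) act m P Q ->
  forall y d, exists rho : nat -> nat, forall g g', hyp_aut H g -> hyp_aut H g' ->
    (forall i : 'I_m, (g i < d)%N) -> (forall i : 'I_m, (g' i < d)%N) ->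
    same_type (fun i : 'I_m => rho (g i)) (fun i : 'I_m => rho (g' i)) ->
    P (act y g) -> Q (act y g').
Proof.
move=> HN [flowM [x0 _] minM] [oP cQ PQ].
have [cM hM act1 actM _] := flowM.
(* Orders are stored as boolean matrices on ['I_d]: these are finitely many, so [R d] is a finite
   union of closed sets. *)
pose tame d x (L : {ffun 'I_d * 'I_d -> bool}) := forall g g',
  hyp_aut H g -> hyp_aut H g' -> forall f f' : 'I_m -> 'I_d,
  (forall i : 'I_m, g i = f i) -> (forall i : 'I_m, g' i = f' i) ->
  (forall i k, L (f i, f k) = L (f' i, f' k)) ->
  P (act x g) -> Q (act x g').
pose ordering d (L : {ffun 'I_d * 'I_d -> bool}) :=
  exists rho : nat -> nat, forall a b : 'I_d, L (a, b) = (rho a < rho b)%N.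
pose R d := [set x | exists2 L : {ffun 'I_d * 'I_d -> bool}, ordering d L & tame d x L].
have cR d : closed (R d).
  have -> : R d = \bigcup_(L in [set L | ordering d L]) [set x | tame d x L].
    by apply/seteqP; split=> x [L ? ?]; exists L.
  apply: closed_bigcup; first exact: finite_finset.
  move=> L _ x xt g g' Gg Gg' f f' gf gf' ff' Px; apply: cQ => B xB.
  have [|z [zt [Pz Bz]]] := xt ((act^~ g @^-1` P) `&` (act^~ g' @^-1` B)).
    apply: filterI; first exact: (act_continuous flowM Gg (open_nbhs_nbhs (conj oP Px))).
    exact: (act_continuous flowM Gg' xB).
  by exists (act z g'); split=> //; exact: zt Pz.
have decR d d' : (d <= d')%N -> R d' `<=` R d.
  move=> dd' x [L [rho Lrho] tL].
  exists [ffun q : 'I_d * 'I_d => L (widen_ord dd' q.1, widen_ord dd' q.2)].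
    by exists rho => a b; rewrite ffunE /= Lrho.
  move=> g g' Gg Gg' f f' gf gf' ff'.
  apply: (tL g g' Gg Gg' (widen_ord dd' \o f) (widen_ord dd' \o f')) => // i k.
  by have := ff' i k; rewrite !ffunE.
have R0 d : R d !=set0.
  (* The color tells whether some automorphism extending [h] moves [x0] into [P]. On the copy given
     by [g0], the natural order works. *)
  pose chi (h : 'I_m -> nat) :=
    `[< exists g, [/\ hyp_aut H g, forall i : 'I_m, g i = h i & P (act x0 g)] >].
  have [g0 Gg0 g0P] := limit_order_ramsey HN d chi.
  exists (act x0 g0), [ffun q : 'I_d * 'I_d => (q.1 < q.2)%N].
    by exists id => a b; rewrite ffunE.
  move=> g g' Gg Gg' f f' gf gf' ff'; rewrite !actM // => Px.
  have chig : chi (g0 \o (g \o val)).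
    by apply/asboolP; exists (g0 \o g); split=> //; exact: hyp_aut_comp.
  move: chig; rewrite (g0P g g') //.
  - move=> /asboolP[k [Gk kE Pk]].
    have [k' [Gk' kK k'K]] := hyp_aut_inv Gk.
    (* [k] and [g0 \o g'] differ by an automorphism fixing [0, m), to which rigidity applies. *)
    have -> : g0 \o g' = k \o (k' \o (g0 \o g')) by apply: funext => i /=; rewrite k'K.
    have Gk'' : hyp_aut H (k' \o (g0 \o g')) by exact: hyp_aut_comp Gk' (hyp_aut_comp Gg0 Gg').
    rewrite -actM //; apply: PQ => // i im /=.
    by have /= <- := kE (Ordinal im); rewrite kK.
  - by move=> i; rewrite gf.
  - by move=> i; rewrite gf'.
  - by move=> i k; have := ff' i k; rewrite !ffunE /= -!gf -!gf'.
have [x xR] := compact_decreasing cM cR R0 decR.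
have RT : (\bigcap_d R d) = setT.
  apply: minM; [by apply: closed_bigI => d _; exact: cR|by exists x => d _|].
  move=> x1 g Gg xR' d _.
  (* Orders are pulled back along [g] from an initial segment that contains the image of [0, d). *)
  pose d' := \max_(i < d) (g i).+1.
  have gd' (i : 'I_d) : (g i < d')%N by exact: (leq_bigmax i).
  have [L [rho Lrho] tL] := xR' d' I.
  pose gg (i : 'I_d) := Ordinal (gd' i).
  exists [ffun q : 'I_d * 'I_d => L (gg q.1, gg q.2)].
    by exists (rho \o g) => a b; rewrite ffunE /= Lrho.
  move=> k k' Gk Gk' f f' kf kf' ff'; rewrite !actM //.
  apply: (tL _ _ _ _ (gg \o f) (gg \o f')); try exact: hyp_aut_comp.
  - by move=> i /=; rewrite kf.
  - by move=> i /=; rewrite kf'.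
  - by move=> i j; have := ff' i j; rewrite !ffunE.
move=> y d; have : (\bigcap_d R d) y by rewrite RT.
move=> /(_ d I)[L [rho Lrho] tL]; exists rho => g g' Gg Gg' gd gd' gg'.
apply: (tL g g' Gg Gg' (fun i => Ordinal (gd i)) (fun i => Ordinal (gd' i))) => // i k.
by rewrite !Lrho; exact: gg'.
Qed.

(** * The enveloping semigroup *)

Definition shift (x : {ptws nat * nat -> bool}) (g : nat -> nat) :
  {ptws nat * nat -> bool} := fun q => x (g q.1, g q.2).

Lemma shift_ambit G z : generic_relation G z -> is_ambit G shift z.
Proof.
move=> zgen; split; first split.
- have -> : [set: {ptws nat * nat -> bool}] =
      [set f : forall _ : nat * nat, bool | forall q, [set: bool] (f q)].
    by apply/seteqP; split.
  exact: (@tychonoff _ (fun _ : nat * nat => bool) (fun=> setT) (fun=> bool_compact)).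
- exact: (@hausdorff_product _ (fun _ : nat * nat => bool) (fun=> discrete_hausdorff)).
- by move=> x; apply: funext => -[].
- by move=> x g h _ _; apply: funext => -[].
- apply: continuous_subspaceT => -[x g]; apply: ptws_cvg => -[i j] O /nbhs_singleton /= Ox.
  exists ([set y : {ptws nat * nat -> bool} | y (g i, g j) = x (g i, g j)],
          [set h : {ptws nat -> nat} | h i = g i] `&`
          [set h : {ptws nat -> nat} | h j = g j]).
    split=> /=; first exact: (ptws_nbhs (discrete_set1 _)).
    by apply: filterI; exact: (ptws_nbhs (discrete_set1 _)).
  by move=> [y h] /= [yx [hi hj]]; rewrite /shift /= hi hj yx.
apply/seteqP; split=> // x _ B /ptws_discrete_nbhs[l lB].
pose d := \max_(q <- l) maxn q.1.+1 q.2.+1.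
have [g Gg gx] := zgen d x.
exists (shift z g); split; first by exists g.
apply: lB => -[i j] ql; have : (maxn i.+1 j.+1 <= d)%N by exact: (leq_bigmax_seq (i, j) ql).
by rewrite geq_max => /andP[/= id jd]; exact: gx.
Qed.

Section FiniteDetermination.
Variables (G : set (nat -> nat)) (M : topologicalType) (act : M -> (nat -> nat) -> M).
Hypotheses (flowM : is_flow G act) (Gid : G id).

(* A test (m, P, Q, y) is passed by f if f y lies in P, and weakly passed if f y
   lies in Q; m witnesses the rigidity of (P, Q). *)
Let test : Type := (nat * set M * set M * M)%type.
Let lev (t : test) := t.1.1.1.
Let inner (t : test) := t.1.1.2.
Let outer (t : test) := t.1.2.
Let pnt (t : test) := t.2.

Let rigid_tests (l : seq test) :=
  forall t, List.In t l -> rigid G act (lev t) (inner t) (outer t).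

Lemma rigid_sub m P Q : rigid G act m P Q -> P `<=` Q.
Proof.
move=> [_ _ PQ] x Px; have [_ _ act1 _ _] := flowM.
by rewrite -(act1 x); apply: PQ.
Qed.

Lemma ptws_rigid_nbhs (f : {ptws M -> M}) A : nbhs f A -> exists l,
  [/\ rigid_tests l, forall t, List.In t l -> inner t (f (pnt t)) &
    forall f', (forall t, List.In t l -> outer t (f' (pnt t))) -> A f'].
Proof.
pose F : set_system (M -> M) := [set B | exists l,
  [/\ rigid_tests l, forall t, List.In t l -> inner t (f (pnt t)) &
    forall f', (forall t, List.In t l -> outer t (f' (pnt t))) -> B f']].
have FF : Filter F.
  split; first by exists [::]; split=> // ? [].
    move=> B C [l [l1 l2 l3]] [k [k1 k2 k3]]; exists (l ++ k); split.
    - by move=> t /List.in_app_iff[/l1|/k1].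
    - by move=> t /List.in_app_iff[/l2|/k2].
    - move=> f' Hf'; split; [apply: l3|apply: k3] => t tl;
        apply/Hf'/List.in_app_iff; [by left|by right].
  by move=> B C BC [l [l1 l2 l3]]; exists l; split=> // f' /l3/BC.
apply: (ptws_cvg FF) => y O fO.
have [m [P [Q [rPQ Pf QO]]]] := rigid_exists flowM Gid fO.
exists [:: (m, P, Q, y)]; split.
- by move=> t [<-|//].
- by move=> t [<-|//].
- by move=> f' Hf' /=; apply: QO; apply: (Hf' (m, P, Q, y)); left.
Qed.

Lemma enveloping_compact : compact (enveloping_semigroup G act).
Proof.
have [cM _ _ _ _] := flowM.
apply: (@subclosed_compact _ _ [set: {ptws M -> M}]) => //; first exact: closed_closure.
have -> : [set: {ptws M -> M}] = [set f : forall _ : M, M | forall y, [set: M] (f y)].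
  by apply/seteqP; split.
exact: (@tychonoff _ (fun _ : M => M) (fun=> setT) (fun=> cM)).
Qed.

(** Near each [f] finitely many tests determine [w]; by compactness one finite list of tests serves
    everywhere. *)
Lemma finite_determination (w : {ptws M -> M} -> bool) :
  {within enveloping_semigroup G act, continuous w} ->
  exists l, rigid_tests l /\ forall f f',
    enveloping_semigroup G act f -> enveloping_semigroup G act f' ->
    (forall t, List.In t l -> inner t (f (pnt t)) -> outer t (f' (pnt t))) ->
    w f = w f'.
Proof.
move=> /subspace_continuousP cw; set E := enveloping_semigroup G act in cw *.
(* [F] is the filter of large lists of tests, the parameter in the near-covering form of
   compactness. *)
pose F : set_system (seq test) := [set B | exists2 l0, rigid_tests l0 &
  forall l, (forall t, List.In t l0 -> List.In t l) -> B l].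
have FF : Filter F.
  split; first by exists [::] => // ? [].
    move=> B C [l lr lB] [k kr kC]; exists (l ++ k).
      by move=> t /List.in_app_iff[/lr|/kr].
    move=> n Hn; split; [apply: lB|apply: kC] => t tl;
        apply/Hn/List.in_app_iff; [by left|by right].
  by move=> B C BC [l lr lB]; exists l => // n /lB/BC.
pose P (l : seq test) (f : {ptws M -> M}) := exists l' b, [/\ rigid_tests l',
  forall t, List.In t l' -> List.In t l, forall t, List.In t l' -> inner t (f (pnt t)) &
  forall f', E f' -> (forall t, List.In t l' -> outer t (f' (pnt t))) -> w f' = b].
have [|l0 l0r l0P] := (compact_near_coveringP E).1 enveloping_compact _ F P FF.
  move=> f Ef; have [l [lr lf lw]] := ptws_rigid_nbhs (cw f Ef _ (discrete_set1 _)).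
  exists ([set f' : {ptws M -> M} | forall t, List.In t l -> inner t (f' (pnt t))],
          [set k | forall t, List.In t l -> List.In t k]).
    split=> /=; last by exists l.
    elim: l lr lf {lw} => [|t l IH] lr lf; first by apply: filterS filterT => f' _ t' [].
    apply: filterS2 (ptws_nbhs (open_nbhs_nbhs (conj _ (lf t _)))) (IH _ _).
    - by move=> f' /= f't Hf' t' [<-//|/Hf'].
    - by have [] := lr t (or_introl erefl).
    - by left.
    - by move=> t' tl; apply: lr; right.
    - by move=> t' tl; apply: lf; right.
  move=> [f' k] /= [f'l lk]; exists l, (w f); split=> // f'' Ef'' Hf''.
  exact: (lw f'' Hf'' Ef'').
exists l0; split=> // f f' Ef Ef' ff'.
have [l [b [lr ll0 lf lw]]] := l0P l0 (fun t tl => tl) f Ef.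
(* The tests in [l] are passed by [f], hence weakly passed by both [f] and [f']. *)
rewrite (lw f) //; last by move=> t tl; apply: (rigid_sub (lr t tl)); exact: lf.
by rewrite (lw f') // => t tl; apply: ff' => //; [exact: ll0|exact: lf].
Qed.

End FiniteDetermination.

(** * The canonical map is not an isomorphism *)

Lemma limit_not_iso N r (H : ('I_r -> nat) -> Prop)
  (S : topologicalType) (actS : S -> (nat -> nat) -> S) (s0 : S)
  (M : topologicalType) (actM : M -> (nat -> nat) -> M) :
  is_limit N H -> greatest_ambit (hyp_aut H) actS s0 ->
  minimal_flow (hyp_aut H) actM -> ~ ambit_iso_enveloping (hyp_aut H) actS s0 actM.
Proof.
move=> HN [_ greatS] minM [phi [psi [[_ phiE phiG phi0] [cpsi psiK _]]]].
have [flowM [y0 _] _] := minM.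
have [z zgen] := exists_generic HN.
have [Phi [[cPhi PhiG] Phi0]] := greatS _ _ _ (shift_ambit zgen).
pose G := hyp_aut H; have Gid : G id := hyp_aut_id H.
pose trans g : {ptws M -> M} := fun y => actM y g.
have Etrans g : G g -> enveloping_semigroup G actM (trans g).
  by move=> Gg; apply: subset_closure; exists g.
(* Through [psi], the function [g |-> z (g 0, g 1)] extends continuously to the enveloping
   semigroup. *)
pose w (f : {ptws M -> M}) : bool := Phi (psi f) (0, 1).
have wE g : G g -> w (trans g) = z (g 0, g 1).
  move=> Gg; have -> : trans g = phi (actS s0 g) by rewrite phiG // phi0.
  by rewrite /w psiK PhiG // Phi0.
have cw : {within enveloping_semigroup G actM, continuous w}.
  move=> f O wO.
  have wO' : nbhs (Phi (psi f)) [set x : {ptws nat * nat -> bool} | O (x (0, 1))].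
    exact: (@ptws_nbhs _ _ (Phi (psi f)) (0, 1) O wO).
  exact: (cpsi f _ (cPhi _ _ wO')).
have [l [lr lw]] := finite_determination flowM Gid cw.
(* A common level for all tests, at least 2 so that it covers the vertices 0 and 1. *)
pose m := maxn 2 (\max_(i < size l) (List.nth i l (0, set0, set0, y0)).1.1.1).
pose t (k : 'I_(size l)) := List.nth k l (0, set0, set0, y0).
have tl k : List.In (t k) l by apply: List.nth_In; exact/ltP.
have tr k : rigid G actM m (t k).1.1.2 (t k).1.2.
  have [oP cQ PQ] := lr _ (tl k); split=> // x g Px Gg gm; apply: PQ => // i im.
  apply: gm; apply: leq_trans im _; rewrite leq_max; apply/orP; right.
  exact: (leq_bigmax k).
apply: (@generic_not_order_determined N r H z m 'I_(size l) HN zgen).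
  exact: leq_maxl.
move=> d.
(* One order for each test: their number does not depend on [d], as the counting requires. *)
have /choice[rho rhoP] k := minimal_flow_tame HN minM (tr k) (t k).2 d.
exists rho => g g' Gg Gg' gd gd' gg'; rewrite -!wE //.
apply: lw; [exact: Etrans|exact: Etrans|] => t0 /(List.In_nth _ _ (0, set0, set0, y0)).
move=> [k [/ltP kl <-]]; exact: (rhoP (Ordinal kl) g g' Gg Gg' gd gd' (gg' _)).
Qed.

Theorem mainTheorem1 (G : set (nat -> nat)) (hG : theorem_group G)
  (S : topologicalType) (actS : S -> (nat -> nat) -> S) (s0 : S)
  (M : topologicalType) (actM : M -> (nat -> nat) -> M) :
  greatest_ambit G actS s0 ->
  universal_minimal_flow G actM ->
  ~ ambit_iso_enveloping G actS s0 actM.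
Proof.
have [N [r [H [HN ->]]]] := theorem_group_limit hG.
by move=> greatS [minM _]; exact: limit_not_iso HN greatS minM.
Qed.
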